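(* Let $K,L\subset\mathbb{R}^n$ be convex bodies and $p>1$. Then for all $\lambda\in(0,1)$, \[ \mathcal{W} \bigl((1-\lambda)\cdot K+_p \lambda \cdot L\bigr)^{p/n} \geqslant \frac{1}{(n!)^{p/n}} \left((1-\lambda ) \mathcal{W}(K)^{p/n} + \lambda \mathcal{W}(L)^{p/n}\right). \]
   Context: A convex body is a nonempty compact convex subset of $\mathbb{R}^n$. $\mathcal{W}(K)=\sum_{i=0}^n \mathrm{V}_i(K)$ is the Wills functional, the sum of the intrinsic volumes $\mathrm{V}_i$ of $K$ (equivalently $\mathcal{W}(K)=\int_{\mathbb{R}^n}e^{-\pi d(x,K)^2}\,\mathrm{d}x$, where $d(x,K)$ is the Euclidean distance from $x$ to $K$). For $p>1$ let $q$ be its Hölder conjugate, $1/p+1/q=1$. For nonempty sets $K,L\subset\mathbb{R}^n$ the $p$-sum is $K+_pL=\{(1-\mu)^{1/q}x+\mu^{1/q}y : x\in K,\ y\in L,\ \mu\in[0,1]\}$, and $\lambda\cdot K=\lambda^{1/p}K$ for $\lambda\geqslant0$. *)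

(* Defs.v *)
From HB Require Import structures.
From mathcomp Require Import all_boot all_order all_algebra.
From mathcomp Require Import all_classical all_reals all_analysis.

Set Implicit Arguments.
Unset Strict Implicit.
Unset Printing Implicit Defensive.

Import Order.TTheory GRing.Theory Num.Theory.
Import numFieldNormedType.Exports.
Local Open Scope classical_set_scope.
Local Open Scope ring_scope.

(* Euclidean norm (the library norm on matrices is the sup norm). *)
Definition eucl_norm (R : realType) (n : nat) (x : 'rV[R]_n) : R :=
  Num.sqrt (\sum_(i < n) x ord0 i ^+ 2).

Definition dist_to (R : realType) (n : nat) (x : 'rV[R]_n) (K : set 'rV[R]_n) : R :=
  inf [set eucl_norm (x - y) | y in K].

Definition convex_set (R : realType) (n : nat) (K : set 'rV[R]_n) : Prop :=
  forall x y t, K x -> K y -> 0 <= t <= 1 -> K ((1 - t) *: x + t *: y).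

Definition convex_body (R : realType) (n : nat) (K : set 'rV[R]_n) : Prop :=
  K !=set0 /\ compact K /\ convex_set K.

(* Lebesgue integral on R^n of a nonnegative function, written as the iterated
   one-dimensional Lebesgue integral (equal to the n-dimensional Lebesgue
   integral for nonnegative measurable functions, by Tonelli). *)
Fixpoint iter_lebesgue_integral (R : realType) (n : nat) :
    ('rV[R]_n -> \bar R) -> \bar R :=
  match n with
  | 0 => fun f => f 0
  | m.+1 => fun f : 'rV[R]_(1 + m) -> \bar R =>
      (\int[@lebesgue_measure R]_(t in [set: R])
         iter_lebesgue_integral
           (fun y : 'rV[R]_m => f (row_mx (const_mx t : 'rV[R]_1) y)))%E
  end.

Definition wills (R : realType) (n : nat) (K : set 'rV[R]_n) : R :=
  fine (iter_lebesgue_integral (fun x => (expR (- pi * dist_to x K ^+ 2))%:E)).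

Definition hconj (R : realType) (p : R) : R := p / (p - 1).

Definition psum (R : realType) (n : nat) (p : R) (K L : set 'rV[R]_n) : set 'rV[R]_n :=
  [set z | exists x y mu, [/\ K x, L y, 0 <= mu <= 1 &
     z = ((1 - mu) `^ (hconj p)^-1) *: x + (mu `^ (hconj p)^-1) *: y]].

Definition pscale (R : realType) (n : nat) (p lambda : R) (K : set 'rV[R]_n) : set 'rV[R]_n :=
  [set (lambda `^ p^-1) *: x | x in K].

(* Main.v *)
(* Let f_K(x) = exp(- pi d(x,K)^2). If a, b >= 0 and a + b <= 1, then
   d(ax + by, aK + bL) <= max(d(x,K), d(y,L)), so f_M(ax + by) >= min(f_K(x), f_L(y))
   as soon as M contains aK + bL. This yields the superadditivity
     W(M) >= a^n W(K) + b^n W(L)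
   in the same way as A + B contains translates of A and of B lying on both sides of
   a hyperplane. Let [k1,k2] and [l1,l2] be the ranges of the first coordinate on K
   and L, and let F, G, H be the integrals of f_K, f_L, f_M over the slices with a
   given first coordinate. Then [a k1 + b l1, a k2 + b l1] receives a copy of F on
   [k1,k2] (pair it with a point of L of first coordinate l1), the interval
   [a k2 + b l1, a k2 + b l2] a copy of G on [l1,l2], and on each outer ray
   H(at + bs) dominates both a^(n-1) F(t) and b^(n-1) G(s), where t and s exceed
   their ranges by the same amount.
   The p-sum of (1 - lambda).K and lambda.L contains aK + bL for
   a = (1 - lambda)^(1/p) (1 - d)^(1/q), b = lambda^(1/p) d^(1/q), and a + b <= 1 by
   Young's inequality. With d proportional to lambda W(L)^(p/n), superadditivity gives
   W(M) >= ((1 - d)^n + d^n) T^(n/p), where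
   T = (1 - lambda) W(K)^(p/n) + lambda W(L)^(p/n),
   and (1 - d)^n + d^n >= 2^(1-n) >= 1/n!. *)
Require Import Defs.
From HB Require Import structures.
From mathcomp Require Import all_boot all_order all_algebra.
From mathcomp Require Import all_classical all_reals all_analysis.
From mathcomp Require Import measurable_realfun.
From mathcomp Require Import ring lra.
Set Implicit Arguments.
Unset Strict Implicit.
Unset Printing Implicit Defensive.
Import Order.TTheory GRing.Theory Num.Theory.
Import numFieldNormedType.Exports.
Local Open Scope classical_set_scope.
Local Open Scope ring_scope.

(** * Integrals of nonnegative functions without measurability *)

Section lower_integral.
Local Open Scope ereal_scope.
Context d (T : measurableType d) (R : realType).
Variable mu : {measure set T -> \bar R}.
Implicit Types (f g : T -> \bar R) (A B D : set T).
Import HBNNSimple.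

(* For f >= 0 the library integral is the supremum of the integrals of the simple
   functions below f, measurable or not; working with this lower integral avoids
   proving that the slice integrals are measurable. *)
Lemma ge0_le_lower_integral D f g : (forall x, D x -> 0 <= f x) ->
  (forall x, D x -> f x <= g x) ->
  \int[mu]_(x in D) f x <= \int[mu]_(x in D) g x.
Proof.
move=> f0 fg.
have g0 x : D x -> 0 <= g x by move=> Dx; rewrite (le_trans (f0 _ Dx))// fg.
rewrite !ge0_integralE//; apply: ereal_sup_le => _ [h hf <-]; exists h => // x.
apply: (le_trans (hf x)); rewrite /patch; case: ifPn => // /set_mem; exact: fg.
Qed.

(** A nonnegative simple function below [f] extended by zero vanishes off [D], so its integral is
    already an integral over [D]. Upper bounds can thus be tested on simple functions, where
    measurability is available. *)
Lemma lower_integral_le D f (C : \bar R) : measurable D ->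
  (forall x, D x -> 0 <= f x) ->
  (forall h : {nnsfun T >-> R}, (forall x, D x -> (h x)%:E <= f x) ->
    \int[mu]_(x in D) (h x)%:E <= C) ->
  \int[mu]_(x in D) f x <= C.
Proof.
move=> mD f0 hC; rewrite ge0_integralE//; apply: ge_ereal_sup => _ [h hf <-].
have hD x : D x -> (h x)%:E <= f x.
  by move=> Dx; have := hf x; rewrite /patch mem_set.
apply: le_trans (hC h hD); rewrite integral_nnsfun//.
rewrite (_ : h \_ D = h :> (T -> R))//.
apply/funext => x; rewrite /patch; case: ifPn => // xD.
have := hf x; rewrite /patch (negbTE xD) lee_fin => hx0.
by apply/eqP; rewrite eq_le hx0 andbT /= /point/= fun_ge0.
Qed.

(** Each simple function below [f] on the union is measurable, so its own integral splits
    exactly. *)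
Lemma lower_integral_setU_le A B f : measurable A -> measurable B ->
  [disjoint A & B] -> (forall x, 0 <= f x) ->
  \int[mu]_(x in A `|` B) f x <= \int[mu]_(x in A) f x + \int[mu]_(x in B) f x.
Proof.
move=> mA mB AB f0; apply: lower_integral_le => //; first exact: measurableU.
move=> h hf; rewrite ge0_integral_setU//=.
- apply: leeD; apply: ge0_le_lower_integral => x Ax; rewrite ?lee_fin//.
  + by apply: hf; left.
  + by apply: hf; right.
- exact/measurable_EFinP/measurable_funTS.
- by move=> x _; rewrite lee_fin.
Qed.

Lemma lower_integral_subset A B f : A `<=` B -> (forall x, 0 <= f x) ->
  \int[mu]_(x in A) f x <= \int[mu]_(x in B) f x.
Proof.
move=> AB f0; rewrite (integral_mkcond A) (integral_mkcond B).
apply: ge0_le_lower_integral => x _; rewrite /patch.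
- by case: ifPn.
- case: ifPn => [/set_mem/AB Bx|_]; first by rewrite mem_set.
  by case: ifPn.
Qed.

(** A simple function below [f] on [A] and another below [f] on [B] glue to a measurable function
    below [f] on the union. *)
Lemma lower_integral_setU_ge A B f : measurable A -> measurable B ->
  [disjoint A & B] -> (forall x, 0 <= f x) ->
  \int[mu]_(x in A) f x + \int[mu]_(x in B) f x <= \int[mu]_(x in A `|` B) f x.
Proof.
move=> mA mB AB f0; set C := (X in _ <= X).
(* Once [C] is finite, terms can be moved across the inequality, and the two suprema on the left are
   bounded one at a time. *)
have [->|Coo] := eqVneq C +oo; first exact: leey.
have IA : \int[mu]_(x in A) f x <= C by apply: lower_integral_subset => // x; left.
have IB : \int[mu]_(x in B) f x <= C by apply: lower_integral_subset => // x; right.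
have fin_lt x : 0 <= x -> x <= C -> x \is a fin_num.
  by move=> x0 xC; rewrite ge0_fin_numE// (le_lt_trans xC)// ltey.
have fB := fin_lt _ (integral_ge0 _ (fun x _ => f0 x)) IB.
rewrite -leeBrDr//; apply: lower_integral_le => // h hA.
have lehA : \int[mu]_(x in A) (h x)%:E <= \int[mu]_(x in A) f x.
  by apply: ge0_le_lower_integral => // x _; rewrite lee_fin.
have fh : \int[mu]_(x in A) (h x)%:E \is a fin_num.
  apply: fin_lt; last exact: le_trans lehA IA.
  by apply: integral_ge0 => x _; rewrite lee_fin.
rewrite leeBrDr// addeC -leeBrDr//; apply: lower_integral_le => // g gB.
rewrite leeBrDr//.
pose k := (fun x => (h x * \1_A x + g x * \1_B x)%:E).
have mk : measurable_fun setT k.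
  by apply/measurable_EFinP; apply: measurable_funD; exact: measurable_funM.
have k0 x : 0 <= k x by rewrite lee_fin addr_ge0// mulr_ge0.
have kA x : A x -> k x = (h x)%:E.
  move=> Ax; rewrite /k !indicE (mem_set Ax) memNset ?mulr1 ?mulr0 ?addr0// => Bx.
  by have /disj_setPS/(_ x) := AB; apply.
have kB x : B x -> k x = (g x)%:E.
  move=> Bx; rewrite /k !indicE (mem_set Bx) memNset ?mulr1 ?mulr0 ?add0r// => Ax.
  by have /disj_setPS/(_ x) := AB; apply.
have -> : \int[mu]_(x in A) (h x)%:E = \int[mu]_(x in A) k x.
  by apply: eq_integral => x /set_mem /kA.
have -> : \int[mu]_(x in B) (g x)%:E = \int[mu]_(x in B) k x.
  by apply: eq_integral => x /set_mem /kB.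
rewrite addeC -ge0_integral_setU//; last exact: measurable_funTS.
apply: ge0_le_lower_integral => // x [Ax|Bx].
  by rewrite kA//; exact: hA.
by rewrite kB//; exact: gB.
Qed.

End lower_integral.

(** * Affine change of variable for lower integrals *)

Section affine_substitution.
Local Open Scope ereal_scope.
Context {R : realType}.
Local Notation mu := (@lebesgue_measure R).
Import HBNNSimple.

(** The pushforward divided by [c] gives half-open intervals their length, hence is Lebesgue measure
    by uniqueness. *)
Lemma pushforward_affine_lebesgue (c d : R) (A : set R) : (0 < c)%R ->
  measurable A ->
  pushforward mu (fun z : measurableTypeR R => (z - d) / c : measurableTypeR R)%R A
    = c%:E * mu A.
Proof.
move=> c0 mA.
pose phi := (fun z : measurableTypeR R => (z - d) / c : measurableTypeR R)%R.
have mphi : measurable_fun [set: measurableTypeR R] phi.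
  by apply: measurable_funM => //; exact: measurable_funB.
have ci0 : (0 <= c^-1)%R by rewrite invr_ge0 ltW.
pose m : {measure set measurableTypeR R -> \bar R} :=
  mscale (NngNum ci0) (pushforward mu phi).
have -> : mu A = m mphi A.
  apply: lebesgue_measure_unique => // _ [[x y] _ <-] /=.
  rewrite /m /= /mscale /= /pushforward.
  rewrite (_ : _ @^-1` _ = `](c * x + d)%R, (c * y + d)%R]%classic); last first.
    apply/seteqP; split => z /=; rewrite !in_itv/= /phi ltr_pdivlMr//
      ler_pdivrMr// ltrBrDr lerBlDr mulrC (mulrC y)//.
  rewrite !lebesgue_measure_itv/= !lte_fin ltrD2r ltr_pM2l//.
  case: ifPn => _; last by rewrite mule0.
  rewrite -!EFinB -EFinM; congr EFin; field; lra.
by rewrite /m/= /mscale/= muleA -EFinM divff ?mul1e// gt_eqF.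
Qed.

(** Only a simple function [h] below [F] is transported: [alpha] times [h] composed with [phi] lies
    below [H] on the preimage of [A], which is contained in [B]. Neither [F] nor [H] has to be
    measurable. *)
Lemma ge0_affine_substitution_le (c d alpha : R) (A B : set R) (F H : R -> \bar R) :
  (0 < c)%R -> (0 <= alpha)%R -> measurable A -> (forall x, 0 <= F x) ->
  (forall x, 0 <= H x) ->
  (forall t, A t -> B (c * t + d)%R /\ alpha%:E * F t <= H (c * t + d)%R) ->
  (c * alpha)%:E * \int[mu]_(t in A) F t <= \int[mu]_(t in B) H t.
Proof.
move=> c0 al0 mA F0 H0 FH.
have [->|al0'] := eqVneq alpha 0%R.
  by rewrite mulr0 mul0e integral_ge0.
have {al0 al0'}al0 : (0 < alpha)%R by rewrite lt_neqAle eq_sym al0' al0.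
have cal : (0 < c * alpha)%R by rewrite mulr_gt0.
rewrite -lee_pdivlMl//; apply: lower_integral_le => // h hF.
rewrite lee_pdivlMl//.
pose phi := (fun z : measurableTypeR R => (z - d) / c : measurableTypeR R)%R.
have mphi : measurable_fun [set: measurableTypeR R] phi.
  by apply: measurable_funM => //; exact: measurable_funB.
have phiE t : (c * phi t + d = t)%R by rewrite /phi; field; lra.
have AB : phi @^-1` A `<=` B by move=> z /= /FH[]; rewrite phiE.
apply: le_trans (lower_integral_subset _ AB H0).
pose g := (fun t => alpha%:E * (h t)%:E).
have mg : measurable_fun setT g.
  by apply: measurable_funeM; exact/measurable_EFinP.
apply: (@le_trans _ _ (\int[mu]_(z in phi @^-1` A) (g \o phi) z)); last first.
  apply: ge0_le_lower_integral => z /= Az.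
    by rewrite mule_ge0// lee_fin// ltW.
  have [_] := FH _ Az; rewrite phiE; apply: le_trans.
  by rewrite /g lee_pmul2l// hF.
rewrite -ge0_integral_pushforward//; last 2 first.
- exact: measurable_funTS.
- by move=> z _; rewrite mule_ge0// lee_fin// ltW.
have ci0 : (0 <= c)%R by rewrite ltW.
rewrite [X in _ <= X](eq_measure_integral (mscale (NngNum ci0) mu)).
  rewrite ge0_integral_mscale//=; last 2 first.
  - exact: measurable_funTS.
  - by move=> z _; rewrite mule_ge0// lee_fin// ltW.
  rewrite /g ge0_integralZl//; last 3 first.
  - exact/measurable_EFinP/measurable_funTS.
  - by move=> z _; rewrite lee_fin.
  - by rewrite lee_fin ltW.
  by rewrite muleA EFinM.
by move=> E mE _ /=; rewrite pushforward_affine_lebesgue.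
Qed.

End affine_substitution.

(** * Superadditivity on the real line *)

Section line.
Local Open Scope ereal_scope.
Context {R : realType}.
Local Notation mu := (@lebesgue_measure R).
Implicit Types f F G H : R -> \bar R.

Lemma lower_integral_splitT f (z : R) : (forall x, 0 <= f x) ->
  \int[mu]_x f x =
  \int[mu]_(x in `]-oo, z[) f x + \int[mu]_(x in `[z, +oo[) f x.
Proof.
move=> f0; rewrite -(setUv `]-oo, z[%classic) setCitvl.
have dis : [disjoint `]-oo, z[%classic & `[z, +oo[%classic].
  by rewrite -setCitvl; apply/disj_setPCl.
by apply/le_anti/andP; split;
  [apply: lower_integral_setU_le|apply: lower_integral_setU_ge].
Qed.

Lemma lower_integral_splity f (y z : R) : (y <= z)%R -> (forall x, 0 <= f x) ->
  \int[mu]_(x in `[y, +oo[) f x =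
  \int[mu]_(x in `[y, z[) f x + \int[mu]_(x in `[z, +oo[) f x.
Proof.
move=> yz f0.
have dis : [disjoint `[y, z[%classic & `[z, +oo[%classic].
  by apply/disj_setPS => x /= []; rewrite !in_itv/= => /andP[_ xz]; lra.
have <- : `[y, z[ `|` `[z, +oo[ = `[y, +oo[%classic.
  apply/seteqP; split => x /=; rewrite !in_itv/= ?andbT.
    by case=> [/andP[]|]; lra.
  by move=> yx; case: (ltP x z) => xz; [left; rewrite yx|right].
by apply/le_anti/andP; split;
  [apply: lower_integral_setU_le|apply: lower_integral_setU_ge].
Qed.

(** The left side is at most a + b times the larger of x and y. This serves the outer rays, where
    one piece of [H] dominates both a piece of [F] and a piece of [G]. *)
Lemma weighted_sum_le (a b : R) (x y z : \bar R) : (0 < a)%R -> (0 < b)%R ->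
  0 <= x -> 0 <= y -> (a + b)%:E * x <= z -> (a + b)%:E * y <= z ->
  a%:E * x + b%:E * y <= z.
Proof.
move=> a0 b0 x0 y0 xz yz.
have ab0 : (0 < a + b)%R by rewrite addr_gt0.
case: z xz yz => [z|_ _|xz _]; last 2 first.
- by rewrite leey.
- have : 0 <= (a + b)%:E * x by rewrite mule_ge0// lee_fin ltW.
  by move/le_trans => /(_ _ xz).
case: x x0 => [x| |] //; last by rewrite gt0_muley ?lte_fin.
case: y y0 => [y| |] //; last by rewrite gt0_muley ?lte_fin.
rewrite -!EFinM -EFinD !lee_fin => y0 x0 xz yz.
have [xy|yx] := leP x y.
  by apply: le_trans yz; rewrite mulrDl lerD2r ler_pM2l.
by apply: le_trans xz; rewrite mulrDl lerD2l ler_pM2l// ltW.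
Qed.

Lemma lower_integral_superadditive (a b al be k1 k2 l1 l2 : R) F G H :
  (0 < a)%R -> (0 < b)%R -> (0 <= al)%R -> (0 <= be)%R ->
  (k1 <= k2)%R -> (l1 <= l2)%R ->
  (forall t, 0 <= F t) -> (forall t, 0 <= G t) -> (forall t, 0 <= H t) ->
  (forall t, (k1 <= t < k2)%R -> al%:E * F t <= H (a * t + b * l1)%R) ->
  (forall s, (l1 <= s < l2)%R -> be%:E * G s <= H (a * k2 + b * s)%R) ->
  (forall r : R, (0 <= r)%R ->
    al%:E * F (k2 + r)%R <= H (a * (k2 + r) + b * (l2 + r))%R /\
    be%:E * G (l2 + r)%R <= H (a * (k2 + r) + b * (l2 + r))%R) ->
  (forall r : R, (0 <= r)%R ->
    al%:E * F (k1 - r)%R <= H (a * (k1 - r) + b * (l1 - r))%R /\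
    be%:E * G (l1 - r)%R <= H (a * (k1 - r) + b * (l1 - r))%R) ->
  (a * al)%:E * \int[mu]_t F t + (b * be)%:E * \int[mu]_t G t
    <= \int[mu]_t H t.
Proof.
move=> a0 b0 al0 be0 k12 l12 F0 G0 H0 HF HG HR HL.
have ab0 : (0 < a + b)%R by rewrite addr_gt0.
have z01 : (a * k1 + b * l1 <= a * k2 + b * l1)%R by rewrite lerD2r ler_pM2l.
have z12 : (a * k2 + b * l1 <= a * k2 + b * l2)%R by rewrite lerD2l ler_pM2l.
(* Half-open pieces tile the line; [k2] and [l2] belong to the right rays, as the case r = 0 of
   [HR]. *)
rewrite (lower_integral_splitT k1 F0) (lower_integral_splity k12 F0).
rewrite (lower_integral_splitT l1 G0) (lower_integral_splity l12 G0).
rewrite (lower_integral_splitT (a * k1 + b * l1)%R H0).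
rewrite (lower_integral_splity z01 H0) (lower_integral_splity z12 H0).
set f1 := \int[mu]_(x in _) F x; set f2 := \int[mu]_(x in _) F x.
set f3 := \int[mu]_(x in _) F x; set g1 := \int[mu]_(x in _) G x.
set g2 := \int[mu]_(x in _) G x; set g3 := \int[mu]_(x in _) G x.
set h1 := \int[mu]_(x in _) H x; set h2 := \int[mu]_(x in _) H x.
set h3 := \int[mu]_(x in _) H x; set h4 := \int[mu]_(x in _) H x.
have f10 : 0 <= f1 by exact: integral_ge0.
have f20 : 0 <= f2 by exact: integral_ge0.
have f30 : 0 <= f3 by exact: integral_ge0.
have g10 : 0 <= g1 by exact: integral_ge0.
have g20 : 0 <= g2 by exact: integral_ge0.
have g30 : 0 <= g3 by exact: integral_ge0.
(* With r = k1 - t, the point a(k1 - r) + b(l1 - r) is (a + b)t + b(l1 - k1): the substitution on a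
   ray has slope a + b. *)
have L : (a * al)%:E * f1 + (b * be)%:E * g1 <= h1.
  rewrite !EFinM -!muleA; apply: weighted_sum_le => //; rewrite ?mule_ge0 ?lee_fin//.
  - rewrite muleA -EFinM /f1 /h1.
    apply: (@ge0_affine_substitution_le _ _ (b * (l1 - k1))%R) => // t /=.
    rewrite !in_itv/= => tk1; split; first by nra.
    have [] := HL (k1 - t)%R; first by lra.
    rewrite opprB addrC subrK => + _; congr (_ <= H _); ring.
  - rewrite muleA -EFinM /g1 /h1.
    apply: (@ge0_affine_substitution_le _ _ (a * (k1 - l1))%R) => // t /=.
    rewrite !in_itv/= => tl1; split; first by nra.
    have [] := HL (l1 - t)%R; first by lra.
    rewrite [X in G X](_ : _ = t); last by ring.
    move=> _; congr (_ <= H _); ring.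
have Rt : (a * al)%:E * f3 + (b * be)%:E * g3 <= h4.
  rewrite !EFinM -!muleA; apply: weighted_sum_le => //; rewrite ?mule_ge0 ?lee_fin//.
  - rewrite muleA -EFinM /f3 /h4.
    apply: (@ge0_affine_substitution_le _ _ (b * (l2 - k2))%R) => // t /=.
    rewrite !in_itv/= !andbT => tk2; split; first by nra.
    have [] := HR (t - k2)%R; first by lra.
    rewrite [X in F X](_ : _ = t); last by ring.
    move=> + _; congr (_ <= H _); ring.
  - rewrite muleA -EFinM /g3 /h4.
    apply: (@ge0_affine_substitution_le _ _ (a * (k2 - l2))%R) => // t /=.
    rewrite !in_itv/= !andbT => tl2; split; first by nra.
    have [] := HR (t - l2)%R; first by lra.
    rewrite [X in G X](_ : _ = t); last by ring.
    move=> _; congr (_ <= H _); ring.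
have M1 : (a * al)%:E * f2 <= h2.
  rewrite /f2 /h2.
  apply: (@ge0_affine_substitution_le _ _ (b * l1)%R) => // t /=.
  rewrite !in_itv/= => tk; split; last exact: HF.
  by rewrite lerD2r ltrD2r ler_pM2l// ltr_pM2l.
have M2 : (b * be)%:E * g2 <= h3.
  rewrite /g2 /h3.
  apply: (@ge0_affine_substitution_le _ _ (a * k2)%R) => // t /=.
  rewrite !in_itv/= => tk; split; last by rewrite addrC; exact: HG.
  by rewrite (addrC (b * t)%R) lerD2l ltrD2l ler_pM2l// ltr_pM2l.
clearbody f1 f2 f3 g1 g2 g3 h1 h2 h3 h4.
rewrite !ge0_muleDr ?adde_ge0//.
apply: le_trans (leeD L (leeD M1 (leeD M2 Rt))).
rewrite addeACA [X in _ + X]addeACA -[X in _ + X]addeA; exact: lexx.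
Qed.
End line.

(** * Iterated integrals and distances *)

Section iterated_integral.
Local Open Scope ereal_scope.
Context {R : realType}.
Local Notation mu := (@lebesgue_measure R).

Lemma iter_lebesgue_integral_ge0 n (f : 'rV[R]_n -> \bar R) :
  (forall x, 0 <= f x) -> 0 <= iter_lebesgue_integral f.
Proof.
elim: n f => [|m IH] f f0 //=; apply: integral_ge0 => t _; exact: IH.
Qed.

Lemma lincomb_row_mx m (a b t s : R) (y z : 'rV[R]_m) :
  (a *: row_mx (const_mx t : 'rV_1) y + b *: row_mx (const_mx s : 'rV_1) z =
  row_mx (const_mx (a * t + b * s) : 'rV_1) (a *: y + b *: z))%R.
Proof.
rewrite !scale_row_mx add_row_mx; congr row_mx.
by apply/rowP => i; rewrite !mxE.
Qed.

Lemma row_mx_const_lrsub m (x : 'rV[R]_(1 + m)) :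
  row_mx (const_mx ((x : 'rV_m.+1) ord0 ord0) : 'rV_1) (rsubmx x) = x.
Proof.
rewrite -[RHS]hsubmxK; congr row_mx.
by apply/rowP => i; rewrite !mxE (ord1 i); congr (x _ _); exact: val_inj.
Qed.

Lemma row_mx_const_ord0 m (t : R) (y : 'rV[R]_m) :
  (row_mx (const_mx t : 'rV_1) y : 'rV_m.+1) ord0 ord0 = t.
Proof.
rewrite [in LHS](_ : ord0 = lshift m ord0 :> 'I_(1 + m)); last exact: val_inj.
by rewrite [LHS]row_mxEl mxE.
Qed.

Lemma row_mx_const_lift m (t : R) (y : 'rV[R]_m) (i : 'I_m) :
  (row_mx (const_mx t : 'rV_1) y : 'rV_m.+1) ord0 (lift ord0 i) = y ord0 i.
Proof.
rewrite [lift _ _](_ : _ = rshift 1 i :> 'I_(1 + m)); last exact: val_inj.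
by rewrite [LHS]row_mxEr.
Qed.

(** By induction on the dimension: the slice at t is compared with the slice at at + c_0, and each
    coordinate contributes one factor [a]. *)
Lemma iter_lebesgue_integral_affine_le n (a : R) (c : 'rV[R]_n)
    (f h : 'rV[R]_n -> \bar R) : (0 <= a)%R ->
  (forall x, 0 <= f x) -> (forall x, 0 <= h x) ->
  (forall x, f x <= h (a *: x + c)%R) ->
  (a ^+ n)%:E * iter_lebesgue_integral f <= iter_lebesgue_integral h.
Proof.
move=> a0; elim: n c f h => [|m IH] c f h f0 h0 fh.
  rewrite /= expr0 mul1e; apply: le_trans (fh 0%R) _.
  by rewrite (_ : (a *: 0 + c)%R = 0%R)//; apply/rowP; case.
have [<-|a_neq0] := eqVneq 0%R a.
  by rewrite expr0n mul0e; exact: iter_lebesgue_integral_ge0.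
have {a_neq0}a_gt0 : (0 < a)%R by rewrite lt_neqAle a_neq0.
rewrite exprS.
apply: (@ge0_affine_substitution_le _ _ (c ord0 ord0)) => //.
- exact: exprn_ge0.
- by move=> t; apply: iter_lebesgue_integral_ge0.
- by move=> t; apply: iter_lebesgue_integral_ge0.
move=> t _; split => //.
apply: (IH (rsubmx (c : 'rV_(1 + m)))) => // y.
apply: le_trans (fh _) _; rewrite le_eqVlt; apply/orP; left; apply/eqP; congr h.
rewrite -[X in (_ + X)%R](@row_mx_const_lrsub m) -[X in (_ + X)%R]scale1r.
by rewrite lincomb_row_mx mul1r scale1r.
Qed.

(** Integrating out the coordinates one by one, with [C] general so that it can absorb the factor
    g(t) of the outer variable. A Gaussian [g] will give finiteness of the Wills integral. *)
Lemma iter_lebesgue_integral_prod_le n (g : R -> R) (J C : R)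
    (f : 'rV[R]_n -> \bar R) :
  measurable_fun setT g -> (forall t, 0 <= g t)%R ->
  \int[mu]_t (g t)%:E = J%:E ->
  (0 <= C)%R -> (forall x, 0 <= f x) ->
  (forall x, f x <= (C * \prod_(i < n) g (x ord0 i))%:E) ->
  iter_lebesgue_integral f <= (C * J ^+ n)%:E.
Proof.
move=> mg g0 gJ.
have J0 : (0 <= J)%R.
  by rewrite -lee_fin -gJ integral_ge0// => t _; rewrite lee_fin.
elim: n C f => [|m IH] C f C0 f0 fC.
  by have := fC 0%R; rewrite big_ord0 expr0.
rewrite /=; apply: (@le_trans _ _ (\int[mu]_t ((C * J ^+ m)%:E * (g t)%:E))).
  apply: ge0_le_lower_integral => t _; first exact: iter_lebesgue_integral_ge0.
  rewrite -EFinM mulrAC; apply: IH => //; first by rewrite mulr_ge0.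
  move=> y; apply: le_trans (fC _) _.
  rewrite big_ord_recl row_mx_const_ord0 mulrA lee_fin.
  by under eq_bigr do rewrite row_mx_const_lift.
rewrite ge0_integralZl//; last 3 first.
- exact/measurable_EFinP.
- by move=> t _; rewrite lee_fin.
- by rewrite lee_fin mulr_ge0// exprn_ge0.
by rewrite gJ -EFinM -mulrA -exprSr.
Qed.

End iterated_integral.

(** * Euclidean norm and distance to a set *)

Section distance.
Context {R : realType}.

Lemma eucl_norm_ge0 n (x : 'rV[R]_n) : 0 <= eucl_norm x.
Proof. exact: sqrtr_ge0. Qed.

Lemma coord_le_eucl_norm n (x : 'rV[R]_n) i : `|x ord0 i| <= eucl_norm x.
Proof.
rewrite -sqrtr_sqr ler_wsqrtr// (bigD1 i)//= lerDl.
by apply: sumr_ge0 => j _; exact: sqr_ge0.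
Qed.

Lemma eucl_norm_row_mx0 m (r : R) :
  eucl_norm (row_mx (const_mx r : 'rV_1) (0 : 'rV_m)) = `|r|.
Proof.
rewrite /eucl_norm (@big_ord_recl _ _ _ m) row_mx_const_ord0.
rewrite big1 ?addr0 ?sqrtr_sqr// => i _.
by rewrite row_mx_const_lift mxE expr0n.
Qed.

Lemma eucl_norm_lincomb_le n (a b r : R) (x y : 'rV[R]_n) :
  0 <= a -> 0 <= b -> a + b <= 1 -> eucl_norm x <= r -> eucl_norm y <= r ->
  eucl_norm (a *: x + b *: y) <= r.
Proof.
move=> a0 b0 ab xr yr.
have r0 : 0 <= r by rewrite (le_trans _ xr)// eucl_norm_ge0.
have sqr_norm (z : 'rV[R]_n) : eucl_norm z <= r -> \sum_(i < n) z ord0 i ^+ 2 <= r ^+ 2.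
  rewrite -(@ler_pXn2r _ 2)// ?nnegrE ?eucl_norm_ge0// sqr_sqrtr//.
  by apply: sumr_ge0 => i _; exact: sqr_ge0.
rewrite -[leRHS](ger0_norm r0) -sqrtr_sqr.
apply: ler_wsqrtr.
apply: (@le_trans _ _ (a * (\sum_(i < n) x ord0 i ^+ 2) +
                       b * (\sum_(i < n) y ord0 i ^+ 2))).
  (* (au + bv)^2 = (a + b)(au^2 + bv^2) - ab(u - v)^2 *)
  rewrite !mulr_sumr -big_split/=; apply: ler_sum => i _.
  rewrite !mxE; set u := x _ _; set v := y _ _.
  have h1 : 0 <= a * b * (u - v) ^+ 2 by rewrite mulr_ge0 ?sqr_ge0 ?mulr_ge0.
  have h2 : 0 <= (1 - a - b) * (a * u ^+ 2 + b * v ^+ 2).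
    apply: mulr_ge0; first lra.
    by apply: addr_ge0; apply: mulr_ge0; rewrite ?sqr_ge0.
  lra.
have hx := ler_wpM2l a0 (sqr_norm _ xr).
have hy := ler_wpM2l b0 (sqr_norm _ yr).
have : (a + b) * r ^+ 2 <= r ^+ 2 by rewrite ler_piMl// sqr_ge0.
lra.
Qed.

Lemma has_lbound_dist n (x : 'rV[R]_n) (K : set 'rV[R]_n) :
  has_lbound [set eucl_norm (x - y) | y in K].
Proof. by exists 0 => _ [y _ <-]; exact: eucl_norm_ge0. Qed.

Lemma dist_to_le n (x y : 'rV[R]_n) K : K y -> dist_to x K <= eucl_norm (x - y).
Proof. by move=> Ky; apply: ge_inf; [exact: has_lbound_dist|exists y]. Qed.

Lemma dist_to_ge n (x : 'rV[R]_n) (K : set 'rV[R]_n) r : K !=set0 ->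
  (forall y, K y -> r <= eucl_norm (x - y)) -> r <= dist_to x K.
Proof.
move=> [y Ky] Kr; apply: lb_le_inf; first by exists (eucl_norm (x - y)), y.
by move=> _ [z Kz <-]; exact: Kr.
Qed.

Lemma dist_to_ge0 n (x : 'rV[R]_n) (K : set 'rV[R]_n) : K !=set0 -> 0 <= dist_to x K.
Proof. by move=> K0; apply: dist_to_ge => // y _; exact: eucl_norm_ge0. Qed.

(** Take u in K and v in L that attain the distances up to e; then au + bv lies in M and its
    difference from ax + by is a(x - u) + b(y - v). *)
Lemma dist_to_lincomb_le n (a b : R) (x y : 'rV[R]_n) (K L M : set 'rV[R]_n) r :
  K !=set0 -> L !=set0 -> 0 <= a -> 0 <= b -> a + b <= 1 ->
  (forall u v, K u -> L v -> M (a *: u + b *: v)) ->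
  dist_to x K <= r -> dist_to y L <= r -> dist_to (a *: x + b *: y) M <= r.
Proof.
move=> K0 L0 a0 b0 ab KLM xr yr; apply/ler_addgt0Pr => e e0.
have near (z : 'rV[R]_n) (A : set 'rV[R]_n) : A !=set0 -> dist_to z A <= r ->
    exists2 w, A w & eucl_norm (z - w) <= r + e.
  move=> [w Aw] zr.
  have [] := @inf_lt _ [set eucl_norm (z - w) | w in A] (r + e).
  - by exists (eucl_norm (z - w)), w.
  - by apply: le_lt_trans zr _; rewrite ltrDl.
  by move=> _ [v Av <-] /ltW; exists v.
have [u Ku xu] := near _ _ K0 xr; have [v Lv yv] := near _ _ L0 yr.
apply: le_trans (dist_to_le _ (KLM _ _ Ku Lv)) _.
rewrite opprD addrACA -!scalerBr; exact: eucl_norm_lincomb_le.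
Qed.

End distance.

(** * Superadditivity of the Wills functional *)

Section wills.
Context {R : realType}.
Local Notation mu := (@lebesgue_measure R).

Definition gauss_dist n (K : set 'rV[R]_n) (x : 'rV[R]_n) : \bar R :=
  (expR (- pi * dist_to x K ^+ 2))%:E.

Lemma gauss_dist_ge0 n (K : set 'rV[R]_n) x : (0 <= gauss_dist K x)%E.
Proof. by rewrite lee_fin expR_ge0. Qed.

Lemma gauss_dist_le n (K L : set 'rV[R]_n) x y : L !=set0 ->
  dist_to y L <= dist_to x K -> (gauss_dist K x <= gauss_dist L y)%E.
Proof.
move=> L0 yx; rewrite lee_fin ler_expR !mulNr lerN2 ler_pM2l ?pi_gt0//.
by rewrite ler_pXn2r// ?nnegrE ?(le_trans _ yx) ?dist_to_ge0.
Qed.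

Lemma eucl_norm0 n : eucl_norm (0 : 'rV[R]_n) = 0.
Proof. by rewrite /eucl_norm big1 ?sqrtr0// => i _; rewrite mxE expr0n. Qed.

Lemma dist_to_mem n (x : 'rV[R]_n) (K : set 'rV[R]_n) : K x -> dist_to x K <= 0.
Proof. by move=> Kx; rewrite (le_trans (dist_to_le _ Kx))// subrr eucl_norm0. Qed.

Lemma compact_coord_max n (K : set 'rV[R]_n) i : K !=set0 -> compact K ->
  exists2 x, K x & forall y, K y -> y ord0 i <= x ord0 i.
Proof.
move=> K0 cK.
have [|x /set_mem Kx xmax] := @EVT_max_rV R n (fun x => x ord0 i) K K0 cK.
  exact/continuous_subspaceT/coord_continuous.
by exists x => // y Ky; apply: xmax; exact: mem_set.
Qed.

Lemma compact_coord_min n (K : set 'rV[R]_n) i : K !=set0 -> compact K ->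
  exists2 x, K x & forall y, K y -> x ord0 i <= y ord0 i.
Proof.
move=> K0 cK.
have [|x /set_mem Kx xmin] := @EVT_min_rV R n (fun x => x ord0 i) K K0 cK.
  exact/continuous_subspaceT/coord_continuous.
by exists x => // y Ky; apply: xmin; exact: mem_set.
Qed.

Lemma compact_coord_bounded n (K : set 'rV[R]_n) : K !=set0 -> compact K ->
  exists r, forall x, K x -> forall i, `|x ord0 i| <= r.
Proof.
move=> K0 cK.
have bnd i : exists r, forall x, K x -> `|x ord0 i| <= r.
  have [u _ umax] := compact_coord_max i K0 cK.
  have [v _ vmin] := compact_coord_min i K0 cK.
  exists (`|u ord0 i| + `|v ord0 i|) => x Kx.
  have := umax x Kx; have := vmin x Kx.
  have := ler_norm (u ord0 i); have := ler_norm (- v ord0 i).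
  rewrite normrN ler_norml => *.
  have := normr_ge0 (u ord0 i); have := normr_ge0 (v ord0 i) => *.
  by apply/andP; split; lra.
have [f fP] := choice bnd.
exists (\sum_(i < n) `|f i|) => x Kx i.
apply: le_trans (fP i x Kx) _; apply: le_trans (ler_norm _) _.
by rewrite (bigD1 i)//= lerDl sumr_ge0.
Qed.

Lemma gauss_dist_superadditive m (K L M : set 'rV[R]_m.+1) (a b : R) :
  K !=set0 -> compact K -> L !=set0 -> compact L ->
  0 <= a -> 0 <= b -> a + b <= 1 ->
  (forall x y, K x -> L y -> M (a *: x + b *: y)) ->
  ((a ^+ m.+1)%:E * iter_lebesgue_integral (gauss_dist K) +
   (b ^+ m.+1)%:E * iter_lebesgue_integral (gauss_dist L)
   <= iter_lebesgue_integral (gauss_dist M))%E.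
Proof.
move=> K0 cK L0 cL a0 b0 ab KLM.
have [x0 Kx0] := K0; have [y0 Ly0] := L0.
have M0 : M !=set0 by exists (a *: x0 + b *: y0); exact: KLM.
have le_K x y : dist_to y L <= dist_to x K ->
    (gauss_dist K x <= gauss_dist M (a *: x + b *: y))%E.
  by move=> yx; apply: gauss_dist_le => //; exact: (dist_to_lincomb_le K0 L0).
have le_L x y : dist_to x K <= dist_to y L ->
    (gauss_dist L y <= gauss_dist M (a *: x + b *: y))%E.
  by move=> xy; apply: gauss_dist_le => //; exact: (dist_to_lincomb_le K0 L0).
(* The argument on the line needs positive slopes. For a = 0 only the term of [L] remains, and every
   y is paired with the single point [x0] of [K]. *)
have [a_eq0|a_neq0] := eqVneq a 0.
  rewrite {1}a_eq0 expr0n mul0e add0e.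
  apply: (@iter_lebesgue_integral_affine_le R m.+1 b (a *: x0) (gauss_dist L)
    (gauss_dist M) b0) => y; try exact: gauss_dist_ge0.
  rewrite addrC; apply: le_L.
  by rewrite (le_trans (dist_to_mem Kx0))// dist_to_ge0.
have [b_eq0|b_neq0] := eqVneq b 0.
  rewrite {1}b_eq0 expr0n mul0e adde0.
  apply: (@iter_lebesgue_integral_affine_le R m.+1 a (b *: y0) (gauss_dist K)
    (gauss_dist M) a0) => x; try exact: gauss_dist_ge0.
  apply: le_K.
  by rewrite (le_trans (dist_to_mem Ly0))// dist_to_ge0.
have {a_neq0}a_gt0 : 0 < a by rewrite lt_neqAle eq_sym a_neq0.
have {b_neq0}b_gt0 : 0 < b by rewrite lt_neqAle eq_sym b_neq0.
pose slice (N : set 'rV[R]_m.+1) t := iter_lebesgue_integral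
  (fun y : 'rV_m => gauss_dist N (row_mx (const_mx t : 'rV_1) y)).
have slice_ge0 N t : (0 <= slice N t)%E.
  by apply: iter_lebesgue_integral_ge0 => y; exact: gauss_dist_ge0.
(* One point of the hyperplane at height s that is at least as close to [L] as every point at height
   t is to [K] suffices: pairing it with the whole slice of [K] is an affine map with factor [a] in
   the other [m] coordinates. *)
have slice_K t s (y : 'rV_m) :
    (forall x, dist_to (row_mx (const_mx s : 'rV_1) y : 'rV_m.+1) L <=
      dist_to (row_mx (const_mx t : 'rV_1) x : 'rV_m.+1) K) ->
    ((a ^+ m)%:E * slice K t <= slice M (a * t + b * s)%R)%E.
  move=> yx; apply: (@iter_lebesgue_integral_affine_le R m a (b *: y)
    (fun x => gauss_dist K (row_mx (const_mx t : 'rV_1) x : 'rV_m.+1))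
    (fun x => gauss_dist M (row_mx (const_mx (a * t + b * s) : 'rV_1) x : 'rV_m.+1))
    a0) => x; try exact: gauss_dist_ge0.
  by rewrite -lincomb_row_mx; exact: le_K.
have slice_L t s (x : 'rV_m) :
    (forall y, dist_to (row_mx (const_mx t : 'rV_1) x : 'rV_m.+1) K <=
      dist_to (row_mx (const_mx s : 'rV_1) y : 'rV_m.+1) L) ->
    ((b ^+ m)%:E * slice L s <= slice M (a * t + b * s)%R)%E.
  move=> xy; apply: (@iter_lebesgue_integral_affine_le R m b (a *: x)
    (fun y => gauss_dist L (row_mx (const_mx s : 'rV_1) y : 'rV_m.+1))
    (fun y => gauss_dist M (row_mx (const_mx (a * t + b * s) : 'rV_1) y : 'rV_m.+1))
    b0) => y; try exact: gauss_dist_ge0.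
  by rewrite [(b *: y + _)%R]addrC -lincomb_row_mx; exact: le_L.
have [x1 Kx1 x1min] := compact_coord_min ord0 K0 cK.
have [x2 Kx2 x2max] := compact_coord_max ord0 K0 cK.
have [y1 Ly1 y1min] := compact_coord_min ord0 L0 cL.
have [y2 Ly2 y2max] := compact_coord_max ord0 L0 cL.
pose tl (z : 'rV[R]_m.+1) : 'rV_m := rsubmx (z : 'rV_(1 + m)).
have tlK (z : 'rV[R]_m.+1) : row_mx (const_mx (z ord0 ord0) : 'rV_1) (tl z) = z.
  exact: row_mx_const_lrsub.
(* This upper bound and the lower bound [dist_slab] together verify the hypothesis of [slice_K] and
   [slice_L] on the outer rays. *)
have dist_shift (N : set 'rV[R]_m.+1) z r : N z ->
    dist_to (row_mx (const_mx (z ord0 ord0 + r) : 'rV_1) (tl z) : 'rV_m.+1) N <= `|r|.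
  move=> Nz; apply: le_trans (dist_to_le _ Nz) _; rewrite -(eucl_norm_row_mx0 m).
  rewrite -[X in _ - X]tlK -[X in X - _]scale1r -scaleN1r lincomb_row_mx.
  by rewrite !mul1r !mulN1r scale1r scaleN1r subrr addrAC subrr add0r.
have dist_slab (N : set 'rV[R]_m.+1) t r (x : 'rV_m) : N !=set0 ->
    (forall z, N z -> r <= `|t - z ord0 ord0|) ->
    r <= dist_to (row_mx (const_mx t : 'rV_1) x : 'rV_m.+1) N.
  move=> N0 rN; apply: dist_to_ge => // z Nz; apply: le_trans (rN z Nz) _.
  rewrite -[X in X - _](row_mx_const_ord0 t x).
  have := coord_le_eucl_norm ((row_mx (const_mx t : 'rV_1) x : 'rV_m.+1) - z) ord0.
  by rewrite mxE [X in _ + X]mxE.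
have above (r u v : R) : 0 <= r -> v <= u -> r <= `|u + r - v|.
  by move=> r0 vu; rewrite ger0_norm; lra.
have below (r u v : R) : 0 <= r -> u <= v -> r <= `|u - r - v|.
  by move=> r0 uv; rewrite ler0_norm; lra.
(* One factor of each power comes from the first coordinate, the other [m] from the slices. *)
rewrite !exprS; apply: (@lower_integral_superadditive R a b (a ^+ m) (b ^+ m)
  (x1 ord0 ord0) (x2 ord0 ord0) (y1 ord0 ord0) (y2 ord0 ord0)
  (slice K) (slice L) (slice M)) => //.
- exact: exprn_ge0.
- exact: exprn_ge0.
- exact: x1min.
- exact: y1min.
- move=> t _; apply: (slice_K _ _ (tl y1)) => x; rewrite tlK.
  by rewrite (le_trans (dist_to_mem Ly1))// dist_to_ge0.
- move=> s _; apply: (slice_L _ _ (tl x2)) => y; rewrite tlK.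
  by rewrite (le_trans (dist_to_mem Kx2))// dist_to_ge0.
(* An extremal point of one set, moved outwards by r, stays within r of that set, while the slice of
   the other set at excess r is at distance at least r from it. *)
- move=> r r0; split.
  + apply: (slice_K _ _ (tl y2)) => x.
    apply: le_trans (dist_shift _ _ _ Ly2) _; rewrite ger0_norm//.
    by apply: dist_slab => // z /x2max; exact: above.
  + apply: (slice_L _ _ (tl x2)) => y.
    apply: le_trans (dist_shift _ _ _ Kx2) _; rewrite ger0_norm//.
    by apply: dist_slab => // z /y2max; exact: above.
- move=> r r0; split.
  + apply: (slice_K _ _ (tl y1)) => x.
    apply: le_trans (dist_shift _ _ _ Ly1) _; rewrite normrN ger0_norm//.
    by apply: dist_slab => // z /x1min; exact: below.
  + apply: (slice_L _ _ (tl x1)) => y.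
    apply: le_trans (dist_shift _ _ _ Kx1) _; rewrite normrN ger0_norm//.
    by apply: dist_slab => // z /y1min; exact: below.
Qed.

(** As [K] lies in a cube, the integrand is at most a constant times the product of the
    one-dimensional Gaussians exp(-x_i^2). *)
Lemma iter_gauss_dist_lty n (K : set 'rV[R]_n) (r : R) : K !=set0 ->
  (forall x, K x -> forall i, `|x ord0 i| <= r) ->
  (iter_lebesgue_integral (gauss_dist K) < +oo)%E.
Proof.
move=> K0 Kr.
have : (\int[mu]_t (gauss_fun t)%:E)%E \is a fin_num.
  exact/integrable_fin_num/integrableT_gauss.
move=> /fineK/esym gJ; set J := fine _ in gJ.
have C0 : 0 <= expR (pi * (r ^+ 2 *+ n)) by exact: expR_ge0.
apply: le_lt_trans (iter_lebesgue_integral_prod_le (f := gauss_dist K)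
  (@measurable_gauss_fun R) (@gauss_fun_ge0 R) gJ C0 _ _) (ltry _).
  by move=> x; exact: gauss_dist_ge0.
move=> x; rewrite lee_fin /gauss_fun -expR_sum -expRD ler_expR.
rewrite sumrN; set S := \sum_(i < n) _.
have S0 : 0 <= S by apply: sumr_ge0 => i _; exact: sqr_ge0.
(* (x - z)^2 >= x^2 / 2 - z^2 coordinatewise *)
suff dS : S / 2 - r ^+ 2 *+ n <= dist_to x K ^+ 2.
  have : pi * (S / 2 - r ^+ 2 *+ n) <= pi * dist_to x K ^+ 2.
    by rewrite ler_pM2l ?pi_gt0.
  (* The bound pi >= 2 makes up for the factor 1/2 in front of [S]. *)
  have : 2 * (S / 2) <= pi * (S / 2) by rewrite ler_wpM2r ?pi_ge2// divr_ge0.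
  lra.
have [le0|gt0] := leP (S / 2 - r ^+ 2 *+ n) 0.
  by rewrite (le_trans le0)// sqr_ge0.
rewrite -[leLHS]sqr_sqrtr ?(ltW gt0)//.
rewrite ler_pXn2r// ?nnegrE ?sqrtr_ge0 ?dist_to_ge0//.
apply: dist_to_ge => // z Kz; apply: ler_wsqrtr.
rewrite -[in leLHS](card_ord n) -sumr_const /S mulr_suml -sumrB.
apply: ler_sum => i _; rewrite !mxE.
have zr : z ord0 i ^+ 2 <= r ^+ 2.
  by have := Kr z Kz i; rewrite ler_norml => /andP[? ?]; nra.
(* Half of this square is (x - z)^2 - x^2/2 + z^2. *)
have := sqr_ge0 (x ord0 i - 2 * z ord0 i); nra.
Qed.

Lemma fine_lincomb_le (p q : R) (u v w : \bar R) : u \is a fin_num ->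
  v \is a fin_num -> w \is a fin_num ->
  (p%:E * u + q%:E * v <= w)%E -> p * fine u + q * fine v <= fine w.
Proof. by move: u v w => [u| |] [v| |] [w| |]. Qed.

(** Since [fine] sends infinity to 0, the inequality passes from integrals to [wills] only once all
    three are known to be finite; for [M] this comes from the coordinate bound [r]. *)
Lemma wills_superadditive m (K L M : set 'rV[R]_m.+1) (a b r : R) :
  K !=set0 -> compact K -> L !=set0 -> compact L ->
  0 <= a -> 0 <= b -> a + b <= 1 ->
  (forall x y, K x -> L y -> M (a *: x + b *: y)) ->
  (forall x, M x -> forall i, `|x ord0 i| <= r) ->
  a ^+ m.+1 * wills K + b ^+ m.+1 * wills L <= wills M.
Proof.
move=> K0 cK L0 cL a0 b0 ab KLM Mr.
have M0 : M !=set0.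
  by have [x Kx] := K0; have [y Ly] := L0; exists (a *: x + b *: y); exact: KLM.
have I0 (N : set 'rV[R]_m.+1) : (0 <= iter_lebesgue_integral (gauss_dist N))%E.
  by apply: iter_lebesgue_integral_ge0 => x; exact: gauss_dist_ge0.
have finI (N : set 'rV[R]_m.+1) s : N !=set0 ->
    (forall x, N x -> forall i, `|x ord0 i| <= s) ->
    iter_lebesgue_integral (gauss_dist N) \is a fin_num.
  by move=> N0 Ns; rewrite ge0_fin_numE//; exact: iter_gauss_dist_lty N0 Ns.
have [s Ks] := compact_coord_bounded K0 cK.
have [t Lt] := compact_coord_bounded L0 cL.
have := gauss_dist_superadditive K0 cK L0 cL a0 b0 ab KLM.
exact: fine_lincomb_le (finI K s K0 Ks) (finI L t L0 Lt) (finI M r M0 Mr).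
Qed.

End wills.

(** * The optimal weight *)

(** Raising the exponent by one at most halves the sum of powers, while the factorial gains a factor
    of at least 2. *)
Lemma fact_sum_expn_ge1 (R : realFieldType) n (u v : R) :
  (0 < n)%N -> 0 <= u -> 0 <= v -> u + v = 1 ->
  1 <= n`!%:R * (u ^+ n + v ^+ n).
Proof.
case: n => // n _ u0 v0 uv; elim: n => [|n IH]; first by rewrite !expr1 uv mulr1.
(* Chebyshev's sum inequality, as u + v = 1 *)
have cheb : u ^+ n.+1 + v ^+ n.+1 <= 2 * (u ^+ n.+2 + v ^+ n.+2).
  have : 0 <= (u - v) * (u ^+ n.+1 - v ^+ n.+1).
    have [vu|uv'] := leP v u.
      by rewrite mulr_ge0 ?subr_ge0// lerXn2r// nnegrE.
    by rewrite mulr_le0 ?subr_le0 ?(ltW uv')// lerXn2r ?nnegrE// ltW.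
  rewrite (exprS u n.+1) (exprS v n.+1).
  move: (u ^+ n.+1) (v ^+ n.+1) => U V.
  have -> : v = 1 - u by lra.
  lra.
apply: le_trans IH _; rewrite (factS n.+1) natrM -mulrA.
rewrite mulrCA ler_wpM2l//; apply: le_trans cheb _.
by rewrite ler_wpM2r ?ler_nat// addr_ge0 ?exprn_ge0.
Qed.

(** * Coefficients of the p-sum and the final inequality *)

Section main.
Context {R : realType}.

Lemma hconj_inv (p : R) : 1 < p -> (hconj p)^-1 = 1 - p^-1.
Proof. by move=> p1; rewrite /hconj; field; apply/andP; split; lra. Qed.

Lemma powR_weights_le1 (p c d : R) : 1 < p -> 0 <= c <= 1 -> 0 <= d <= 1 ->
  (1 - d) `^ (hconj p)^-1 * (1 - c) `^ p^-1 +
  d `^ (hconj p)^-1 * c `^ p^-1 <= 1.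
Proof.
move=> p1 /andP[c0 c1] /andP[d0 d1].
have p0 : 0 < p by lra.
have q0 : 0 < hconj p by rewrite divr_gt0; lra.
have pq : (hconj p)^-1 + p^-1 = 1 by rewrite hconj_inv// subrK.
have young (x y : R) : 0 <= x -> 0 <= y ->
    x `^ (hconj p)^-1 * y `^ p^-1 <= x / hconj p + y / p.
  move=> x0 y0; have := conjugate_powR (powR_ge0 x (hconj p)^-1) (powR_ge0 y p^-1) q0 p0 pq.
  by rewrite -!powRrM !mulVf ?gt_eqF// !powRr1.
have h1 : 0 <= 1 - d by lra.
have h2 : 0 <= 1 - c by lra.
have := lerD (young _ _ h1 h2) (young _ _ d0 c0).
move=> /le_trans; apply.
by rewrite le_eqVlt -[X in _ == X]pq; apply/orP; left; apply/eqP; ring.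
Qed.

(** With x = c w^(p/n) and y = x/t, one has c^(n/p) w = x^(n/p) = y^(n/p) t^(n/p), and y^(n/q)
    y^(n/p) = y^n. For t the total T, this evaluates each summand at the chosen weight. *)
Lemma powR_weight_expn (p c w t : R) n : 1 < p -> (0 < n)%N -> 0 <= c -> 0 <= w ->
  0 < t ->
  ((c * w `^ (p / n%:R) / t) `^ (hconj p)^-1 * c `^ p^-1) ^+ n * w =
  (c * w `^ (p / n%:R) / t) ^+ n * t `^ (n%:R / p).
Proof.
move=> p1 n0 c0 w0 t0; set x := c * _; set y := x / t.
have p0 : 0 < p by lra.
have n0' : (0 : R) < n%:R by rewrite ltr0n.
have x0 : 0 <= x by rewrite mulr_ge0 ?powR_ge0.
have y0 : 0 <= y by rewrite divr_ge0// ltW.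
have xn : c `^ (n%:R / p) * w = x `^ (n%:R / p).
  rewrite /x powRM ?powR_ge0// -powRrM.
  by rewrite (_ : p / n%:R * (n%:R / p) = 1) ?powRr1//; field; apply/andP; split; lra.
have yn : y ^+ n = y `^ (n%:R * (hconj p)^-1) * y `^ (n%:R / p).
  have e : n%:R * (hconj p)^-1 + n%:R / p = n%:R.
    by rewrite hconj_inv// mulrBr mulr1 subrK.
  rewrite -powRD; last by rewrite e gt_eqF.
  by rewrite e powR_mulrn.
have root z e : (z `^ e) ^+ n = z `^ (n%:R * e).
  by rewrite -powR_mulrn ?powR_ge0// -powRrM mulrC.
rewrite exprMn !root -mulrA xn yn -mulrA -powRM ?(ltW t0)//.
by rewrite /y divfK// gt_eqF.
Qed.

Lemma powR_le1 (x e : R) : 0 <= x <= 1 -> 0 <= e -> x `^ e <= 1.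
Proof.
move=> /andP[x0 x1] e0; have -> : 1 = 1 `^ e by rewrite powR1.
by rewrite ge0_ler_powR// nnegrE.
Qed.

(** All scalar factors are powers of numbers in [0,1] with nonnegative exponents, so they only
    shrink coordinates. This supplies the bound that makes the Wills integral of the p-sum
    finite. *)
Lemma psum_pscale_bounded n (p lambda r s : R) (K L : set 'rV[R]_n) :
  1 < p -> 0 <= lambda <= 1 ->
  (forall x, K x -> forall i, `|x ord0 i| <= r) ->
  (forall x, L x -> forall i, `|x ord0 i| <= s) ->
  forall z, psum p (pscale p (1 - lambda) K) (pscale p lambda L) z ->
    forall i, `|z ord0 i| <= r + s.
Proof.
move=> p1 /andP[l0 l1] Kr Ls z [_ [_ [d [[x Kx <-] [y Ly <-] /andP[d0 d1] ->]]]] i.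
have pi0 : 0 <= p^-1 by rewrite invr_ge0; lra.
have qi0 : 0 <= (hconj p)^-1.
  by rewrite invr_ge0 divr_ge0; lra.
have contract (u v e f t : R) : 0 <= u <= 1 -> 0 <= v <= 1 -> 0 <= e -> 0 <= f ->
    `|u `^ e * (v `^ f * t)| <= `|t|.
  move=> u1 v1 e0 f0; rewrite mulrA normrM ler_piMl//.
  by rewrite ger0_norm ?mulr_ge0 ?powR_ge0// mulr_ile1 ?powR_ge0 ?powR_le1.
rewrite !mxE (le_trans (ler_normD _ _))// lerD//.
  by apply: le_trans (Kr x Kx i); apply: contract => //; apply/andP; split; lra.
by apply: le_trans (Ls y Ly i); apply: contract => //; apply/andP; split; lra.
Qed.

(* The choice [d = Y / (X + Y)] below makes the two weighted summands
   proportional to [X] and [Y]. *)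
Lemma powR_weights_optimal (p c A B W : R) n :
  1 < p -> (0 < n)%N -> 0 <= c <= 1 -> 0 <= A -> 0 <= B -> 0 <= W ->
  (forall d, 0 <= d <= 1 ->
    ((1 - d) `^ (hconj p)^-1 * (1 - c) `^ p^-1) ^+ n * A +
    (d `^ (hconj p)^-1 * c `^ p^-1) ^+ n * B <= W) ->
  (n`!%:R `^ (p / n%:R))^-1 *
    ((1 - c) * A `^ (p / n%:R) + c * B `^ (p / n%:R)) <= W `^ (p / n%:R).
Proof.
move=> p1 n0 /andP[c0 c1] A0 B0 W0 weighted.
have p0 : 0 < p by lra.
have n0' : (0 : R) < n%:R by rewrite ltr0n.
have s0 : 0 < p / n%:R by rewrite divr_gt0.
set X := (1 - c) * _; set Y := c * _.
have X0 : 0 <= X by rewrite mulr_ge0 ?powR_ge0//; lra.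
have Y0 : 0 <= Y by rewrite mulr_ge0 ?powR_ge0.
have [T0|T0] := leP (X + Y) 0.
  apply: (@le_trans _ _ 0); last exact: powR_ge0.
  by rewrite mulr_ge0_le0// invr_ge0 powR_ge0.
set T := X + Y in T0 *.
have f0 : 0 < (n`!%:R : R) by rewrite ltr0n fact_gt0.
rewrite ler_pdivrMl ?powR_gt0// -powRM ?(ltW f0)//.
(* Monotonicity of the power p/n reduces the claim to T^(n/p) <= n! W. *)
have TE : T = (T `^ (n%:R / p)) `^ (p / n%:R).
  rewrite -powRrM (_ : _ * _ = 1) ?powRr1 ?(ltW T0)//.
  by field; apply/andP; split; lra.
rewrite [leLHS]TE.
have fW0 : 0 <= n`!%:R * W by rewrite mulr_ge0// ltW.
apply: ge0_ler_powR; rewrite ?nnegrE ?powR_ge0 ?(ltW s0)//.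
have XT : X / T = 1 - Y / T by rewrite /T; field; rewrite gt_eqF.
have d1 : 0 <= Y / T <= 1.
  by rewrite divr_ge0 ?(ltW T0)//= ler_pdivrMr// mul1r lerDr.
have := weighted _ d1.
rewrite -XT !powR_weight_expn//; last by lra.
rewrite -mulrDl => WM.
apply: le_trans (ler_wpM2l (ltW f0) WM).
rewrite mulrA ler_peMl ?powR_ge0// fact_sum_expn_ge1//.
- by rewrite divr_ge0// ltW.
- by rewrite divr_ge0// ltW.
- by rewrite XT subrK.
Qed.

End main.

Theorem theorem1p2 (R : realType) (n : nat) (K L : set 'rV[R]_n) (p lambda : R) :
  (0 < n)%N -> convex_body K -> convex_body L -> 1 < p -> 0 < lambda < 1 ->
  wills (psum p (pscale p (1 - lambda) K) (pscale p lambda L)) `^ (p / n%:R)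
  >= (n`!%:R `^ (p / n%:R))^-1 *
     ((1 - lambda) * wills K `^ (p / n%:R) + lambda * wills L `^ (p / n%:R)).
Proof.
case: n K L => // m K L _ [K0 [cK _]] [L0 [cL _]] p1 /andP[l0 l1].
have l01 : 0 <= lambda <= 1 by rewrite !ltW.
have wills_ge0 (N : set 'rV[R]_m.+1) : 0 <= wills N.
  by apply: fine_ge0; apply: iter_lebesgue_integral_ge0 => x; rewrite lee_fin expR_ge0.
have [r Kr] := compact_coord_bounded K0 cK.
have [s Ls] := compact_coord_bounded L0 cL.
apply: powR_weights_optimal => // d d01.
apply: (wills_superadditive K0 cK L0 cL _ _ (powR_weights_le1 p1 l01 d01) _
  (psum_pscale_bounded p1 l01 Kr Ls)).
- by rewrite mulr_ge0// powR_ge0.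
- by rewrite mulr_ge0// powR_ge0.
(* The weight [d] is the parameter of the p-sum; merging the scalars gives the two coefficients. *)
move=> x y Kx Ly; exists ((1 - lambda) `^ p^-1 *: x), (lambda `^ p^-1 *: y), d.
by split=> //; [exists x|exists y|rewrite !scalerA].
Qed.
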